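(* Let $n\ge2$ and let $K$ be a knot whose projection has a plat presentation $p_{2n}(w)$ with $w=\sigma_{k_1}^{\epsilon_1}\sigma_{k_2}^{\epsilon_2}\cdots\sigma_{k_m}^{\epsilon_m}$, where the $\epsilon_i$ are non-zero integers, $k_i\in\{1,\dots,2n-1\}$ for $1\le i\le m$, and $k_j\ne k_{j+1}$ for $1\le j\le m-1$. With $v(i)\in\{0,1\}$ ($1\le i\le m$) defined as in the context, the writhe of $K$ (computed in the diagram $p_{2n}(w)$) is $$w(K)=\sum_{i=1}^m(-1)^{v(i)}\epsilon_i .$$
   Context: Braids and plats. A word in $\mathbb{B}_{2n}$ is drawn as a braid diagram on $2n$ vertical strings, read from top to bottom (the first letter is topmost), with upper endpoints numbered $1,\dots,2n$ from left to right on the $x$-axis. $\sigma_i$ is a crossing between the strings in positions $i,i+1$ whose overcrossing strand runs from bottom-left to top-right; $\sigma_i^{-1}$ is the opposite crossing. The plat $p_{2n}(w)$ is obtained from the braid $w$ by joining the upper endpoints $2i-1,2i$ by trivial arcs $\delta_i$ above the braid and the bottom endpoints in positions $2i-1,2i$ by trivial arcs below the braid, $1\le i\le n$. Writhe: the sum over all crossings of the crossing sign ($+1$ for a right-handed crossing, $-1$ for a left-handed crossing) after orienting $K$; thus a crossing $\sigma_i$ whose two strands are both oriented up or both oriented down has sign $+1$. Permutation matrices: $\mathcal{P}(\sigma_i^{\pm1})$ is the $2n\times2n$ matrix obtained from the identity matrix $I$ by interchanging the $i$-th and $(i+1)$-st rows; $\mathcal{P}$ extends to a homomorphism $\mathbb{B}_{2n}\to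 GL_{2n}(\mathbb{Z})$. The numbers $v(i)$: orient $K$ so that $\delta_1$ is directed from the point $1$ to the point $2$ (clockwise); this orients every $\delta_i$. Define $r=[r(1),\dots,r(2n)]$ by $r(j)=1$ if the upper endpoint $j$ is the initial point of the oriented arc $\delta_i$ containing it, and $r(j)=2$ if it is the terminal point. Put $r_0=r$ and, for $1\le i\le m$, $$r_i=[r_i(1),\dots,r_i(2n)]=r\,\mathcal{P}(\sigma_{k_1}^{\epsilon_1}\sigma_{k_2}^{\epsilon_2}\cdots\sigma_{k_i}^{\epsilon_i}).$$ Then $v(i)=0$ if $r_{i-1}(k_i)=r_{i-1}(k_i+1)$, and $v(i)=1$ if $r_{i-1}(k_i)\neq r_{i-1}(k_i+1)$. *)

(* Defs.v *)
From HB Require Import structures.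
From mathcomp Require Import all_boot all_order all_algebra all_fingroup.

Set Implicit Arguments.
Unset Strict Implicit.
Unset Printing Implicit Defensive.

Import GRing.Theory.
Local Open Scope ring_scope.

(** Everything is numbered from 0: positions are [0 .. N-1], and [k : 'I_N.-1]
    stands for the generator $\sigma_{k+1}$, which crosses positions [k] and
    [k+1]. *)

Section Braids.
Variable N : nat.

Lemma rpos_subproof (k : 'I_N.-1) : (k.+1 < N)%N.
Proof. by rewrite -ltn_predRL. Qed.

Definition lpos (k : 'I_N.-1) : 'I_N := widen_ord (leq_pred N) k.
Definition rpos (k : 'I_N.-1) : 'I_N := Ordinal (rpos_subproof k).

(** [(k, true)] is $\sigma$ and [(k, false)] is $\sigma^{-1}$; the head of a
    word is its topmost crossing. *)
Definition letter : Type := ('I_N.-1 * bool)%type.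

Definition syllable (k : 'I_N.-1) (e : int) : seq letter :=
  nseq `|e|%N (k, 0 < e).

(** The first [p] syllables of the word; all of them when [p = m]. *)
Definition word_prefix (m : nat) (k : 'I_m -> 'I_N.-1) (eps : 'I_m -> int)
    (p : nat) : seq letter :=
  \big[cat/[::]]_(i < m | (i < p)%N) syllable (k i) (eps i).

Definition braid_word (m : nat) (k : 'I_m -> 'I_N.-1) (eps : 'I_m -> int) :
    seq letter :=
  \big[cat/[::]]_(i < m) syllable (k i) (eps i).

Definition Pletter (a : letter) : 'M[int]_N :=
  xrow (lpos a.1) (rpos a.1) 1%:M.

Definition Pmx (w : seq letter) : 'M[int]_N :=
  \big[mulmx/1%:M]_(a <- w) Pletter a.

End Braids.

Section Plats.
Variable n : nat.

Lemma cap_left_subproof (i : 'I_n) : (i.*2 < n.*2)%N.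
Proof. by rewrite ltn_double. Qed.
Lemma cap_right_subproof (i : 'I_n) : (i.*2.+1 < n.*2)%N.
Proof. by rewrite ltn_Sdouble. Qed.

Definition cap_left (i : 'I_n) : 'I_n.*2 := Ordinal (cap_left_subproof i).
Definition cap_right (i : 'I_n) : 'I_n.*2 := Ordinal (cap_right_subproof i).

Variable w : seq (letter n.*2).

(** The plat diagram of [w] is cut at the heights between consecutive
    crossings. The point [(l, j)] lies in position [j], just above the [l]-th
    crossing; [(0, j)] is an upper and [(size w, j)] a bottom endpoint of the
    braid. *)
Definition point : Type := ('I_(size w).+1 * 'I_n.*2)%type.

Definition letter_at (l : 'I_(size w)) : letter n.*2 := tnth (in_tuple w) l.

Definition edge : Type := ('I_n + 'I_(size w) * 'I_n.*2 + 'I_n)%type.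
Definition top_arc (i : 'I_n) : edge := inl (inl i).
Definition strand (l : 'I_(size w)) (j : 'I_n.*2) : edge := inl (inr (l, j)).
Definition bottom_arc (i : 'I_n) : edge := inr i.

(** [strand l j] is the part of the braid between the heights [l] and [l+1]
    whose upper end is in position [j]. *)
Definition ends (e : edge) : point * point :=
  match e with
  | inl (inl i) => ((ord0, cap_left i), (ord0, cap_right i))
  | inl (inr (l, j)) =>
      let k := (letter_at l).1 in
      ((widen_ord (leqnSn _) l, j),
       (lift ord0 l, tperm (lpos k) (rpos k) j))
  | inr i => ((ord_max, cap_left i), (ord_max, cap_right i))
  end.

Definition adjacent : rel point :=
  fun x y => [exists e : edge, (ends e == (x, y)) || (ends e == (y, x))].

(** The curve is a disjoint union of circles, so it is a knot exactly when it
    has one connected component. The two strands of a crossing share no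
    [point]. *)
Definition is_knot : Prop := forall x y : point, connect adjacent x y.

(** [o e = true] directs [e] from the first to the second of its [ends]. *)
Definition source (o : edge -> bool) (e : edge) : point :=
  if o e then (ends e).1 else (ends e).2.
Definition target (o : edge -> bool) (e : edge) : point :=
  if o e then (ends e).2 else (ends e).1.

Definition is_orientation (o : edge -> bool) : Prop :=
  forall x : point,
    (exists! e, source o e = x) /\ (exists! e, target o e = x).

Definition clockwise (o : edge -> bool) : Prop :=
  forall i : 'I_n, i = 0%N :> nat ->
    source o (top_arc i) = (ord0, cap_left i) /\
    target o (top_arc i) = (ord0, cap_right i).

(** Planar direction vector; the second coordinate points upwards, whereas
    levels are numbered downwards. *)
Definition direction (o : edge -> bool) (e : edge) : int * int :=
  let s := source o e in let t := target o e in
  ((t.2 : nat)%:Z - (s.2 : nat)%:Z, (s.1 : nat)%:Z - (t.1 : nat)%:Z).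

(** The overcrossing strand of $\sigma$ runs from bottom left to top right, so
    its upper end is the right one. *)
Definition over_strand (l : 'I_(size w)) : edge :=
  let a := letter_at l in strand l (if a.2 then rpos a.1 else lpos a.1).
Definition under_strand (l : 'I_(size w)) : edge :=
  let a := letter_at l in strand l (if a.2 then lpos a.1 else rpos a.1).

(** A crossing is right-handed when the overcrossing direction followed by the
    undercrossing direction is a positive basis of the plane. *)
Definition crossing_sign (o : edge -> bool) (l : 'I_(size w)) : int :=
  let a := direction o (over_strand l) in
  let b := direction o (under_strand l) in
  Num.sg (a.1 * b.2 - a.2 * b.1).

Definition writhe (o : edge -> bool) : int :=
  \sum_(l < size w) crossing_sign o l.

Definition rvec (o : edge -> bool) : 'rV[int]_n.*2 :=
  \row_j (if [exists i : 'I_n, source o (top_arc i) == (ord0, j)]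
          then 1 else 2).

End Plats.

(** [vnum k eps r i] is $v(i+1)$: row [r *m Pmx _] is $r_i$, obtained after the
    [i] syllables that precede syllable [i]. *)
Definition vnum (N m : nat) (k : 'I_m -> 'I_N.-1) (eps : 'I_m -> int)
    (r : 'rV[int]_N) (i : 'I_m) : nat :=
  let ri := r *m Pmx (word_prefix k eps i) in
  if ri 0 (lpos (k i)) == ri 0 (rpos (k i)) then 0%N else 1%N.

(* Main.v *)
Require Import Defs.
From HB Require Import structures.
From mathcomp Require Import all_boot all_order all_algebra all_fingroup.
From mathcomp Require Import zify ring.

Set Implicit Arguments.
Unset Strict Implicit.
Unset Printing Implicit Defensive.

Import GRing.Theory.
Local Open Scope ring_scope.

(** The sign of a crossing [(k, b)] is the sign of the letter when its two
    strands run in parallel (both up or both down), and the opposite sign when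
    they are antiparallel ([crossing_signE]). So only the relative direction of
    the two strands matters. Three observations turn this into the formula.

    - Two orientations of a connected diagram agree everywhere or disagree
      everywhere: at each point the orientation of one incident edge forces that
      of the other, and connectedness propagates the comparison
      ([orientation_unique_up_to_reversal]). Reversing both strands of a
      crossing preserves its sign, so the writhe may be computed with [o1].

    - A strand keeps its direction as it passes through a crossing and merely
      changes position by the transposition of that crossing. At the top,
      [rvec o1] records the directions (2 for down, 1 for up), since a
      strand goes down exactly when the cap above it ends there. Right
      multiplication by [Pletter] applies the same transposition to the entries
      of a row, so [rvec o1 *m Pmx (take l w)] records the directions at height
      [l] ([row_records_directions]).

    - A syllable repeats one letter, and the transposition of positions [k] and
      [k + 1] does not affect whether the entries there are equal. Hence all
      crossings of a syllable have the same sign, and the syllable with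
      exponent [e] contributes $\pm e$ ([row_writhe_syllable]).

    The last point is a statement about words and rows only; it is phrased
    with [row_writhe], which reads a word from the top while updating
    the row. *)

(** * Writhe of a word relative to a row of directions *)

Section RowWrithe.
Variable N : nat.
Implicit Types (a : letter N) (w : seq (letter N)) (r : 'rV[int]_N).

Definition letter_sign a : int := if a.2 then 1 else -1.

Definition parallel_sign r (k : 'I_N.-1) : int :=
  (-1) ^+ (if r 0 (lpos k) == r 0 (rpos k) then 0%N else 1%N).

Fixpoint row_writhe r w : int :=
  if w is a :: w' then
    letter_sign a * parallel_sign r a.1 + row_writhe (r *m Pletter a) w'
  else 0.

Lemma mul_row_Pletter r a j :
  (r *m Pletter a) 0 j = r 0 (tperm (lpos a.1) (rpos a.1) j).
Proof.
rewrite /Pletter /xrow row_permE mulmx1.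
by rewrite -[X in perm_mx X](invgK (tperm _ _)) tpermV -col_permE mxE.
Qed.

Lemma Pmx_cons a w : Pmx (a :: w) = Pletter a *m Pmx w.
Proof. exact: big_cons. Qed.

Lemma Pmx_cat w1 w2 : Pmx (w1 ++ w2) = Pmx w1 *m Pmx w2.
Proof.
elim: w1 => [|a w1 IH]; first by rewrite {2}/Pmx big_nil mul1mx.
by rewrite cat_cons !Pmx_cons IH mulmxA.
Qed.

Lemma Pmx_rcons w a : Pmx (rcons w a) = Pmx w *m Pletter a.
Proof. by rewrite -cats1 Pmx_cat Pmx_cons {2}/Pmx big_nil mulmx1. Qed.

Lemma row_writhe_cat r w1 w2 :
  row_writhe r (w1 ++ w2) = row_writhe r w1 + row_writhe (r *m Pmx w1) w2.
Proof.
elim: w1 r => [|a w1 IH] r /=; first by rewrite /Pmx big_nil mulmx1 add0r.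
by rewrite IH Pmx_cons mulmxA addrA.
Qed.

Lemma parallel_sign_mul_Pletter r a :
  parallel_sign (r *m Pletter a) a.1 = parallel_sign r a.1.
Proof. by rewrite /parallel_sign !mul_row_Pletter tpermL tpermR eq_sym. Qed.

(** All crossings of a syllable have the sign of the first one, because the
    transposition swaps the two entries that are compared. *)
Lemma row_writhe_syllable r k (e : int) :
  row_writhe r (syllable k e) = parallel_sign r k * e.
Proof.
have nseqE p a q :
    row_writhe q (nseq p a) = parallel_sign q a.1 * (letter_sign a * p%:Z).
  elim: p q => [|p IH] q /=; first by rewrite !mulr0.
  rewrite IH parallel_sign_mul_Pletter -[in RHS]addn1 PoszD; ring.
rewrite /syllable nseqE /letter_sign /=; congr (_ * _).
by case: ifP; lia.
Qed.

(** Splitting off the first syllable multiplies the row by its matrix, which is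
    the first factor of every later [Pmx (word_prefix _ _ _)]. *)
Lemma row_writhe_braid_word r m (k : 'I_m -> 'I_N.-1) (eps : 'I_m -> int) :
  row_writhe r (braid_word k eps) =
    \sum_(i < m) (-1) ^+ vnum k eps r i * eps i.
Proof.
elim: m k eps r => [|m IH] k eps r; first by rewrite /braid_word !big_ord0.
rewrite /braid_word !big_ord_recl row_writhe_cat row_writhe_syllable.
congr (_ + _).
  rewrite /vnum /word_prefix big_pred0; last by move=> i.
  by rewrite /Pmx big_nil mulmx1.
rewrite -/(braid_word (fun i => k (lift ord0 i)) (fun i => eps (lift ord0 i))).
rewrite IH; apply: eq_bigr => i _; congr (_ ^+ _ * _).
rewrite /vnum -mulmxA -Pmx_cat.
suff -> : word_prefix k eps (lift ord0 i) =
    syllable (k ord0) (eps ord0) ++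
    word_prefix (fun i => k (lift ord0 i)) (fun i => eps (lift ord0 i)) i by [].
rewrite /word_prefix big_mkcond big_ord_recl /=; congr (_ ++ _).
by rewrite [RHS]big_mkcond.
Qed.

Lemma row_writheE r w :
  row_writhe r w = \sum_(l < size w)
    let a := tnth (in_tuple w) l in
    letter_sign a * parallel_sign (r *m Pmx (take l w)) a.1.
Proof.
elim: w r => [|a w IH] r; first by rewrite big_ord0.
rewrite /= big_ord_recl /= {1}/Pmx big_nil mulmx1; congr (_ + _).
rewrite IH; apply: eq_bigr => l _.
have -> : tnth (in_tuple (a :: w)) (lift ord0 l) = tnth (in_tuple w) l.
  by rewrite !(tnth_nth a).
by rewrite /= Pmx_cons mulmxA.
Qed.

End RowWrithe.

(** * Orientations of a plat *)

Section Orientations.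
Variables (n : nat) (w : seq (letter n.*2)).
Implicit Types (o : edge w -> bool) (e f : edge w) (x y : point w).

Definition incident e x := ((ends e).1 == x) || ((ends e).2 == x).

Lemma ends_neq e : (ends e).1 != (ends e).2.
Proof.
by case: e => [[i|[l j]]|i] /=; apply/eqP => -[] /=;
  rewrite ?/bump; lia.
Qed.

(** One of two edges meeting at [x] leaves [x] and the other one enters it, so
    their orientations differ exactly when both have [x] as first end or both
    have [x] as second end. *)
Lemma orientation_at_point o e f x :
  is_orientation o -> e != f -> incident e x -> incident f x ->
  o e (+) o f = (((ends e).1 == x) == ((ends f).1 == x)).
Proof.
move=> /(_ x)[[es [_ es_uniq]] [et [_ et_uniq]]] /eqP e_neq_f.
have not_both_sources : source o e = x -> source o f = x -> False.
  by move=> /es_uniq Ee /es_uniq; rewrite Ee.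
have not_both_targets : target o e = x -> target o f = x -> False.
  by move=> /et_uniq Ee /et_uniq; rewrite Ee.
have second g : (ends g).2 == x -> ((ends g).1 == x) = false.
  by move=> /eqP <-; apply: negbTE; exact: ends_neq.
move: not_both_sources not_both_targets; rewrite /incident /source /target.
by case: (o e); case: (o f) => src tgt /orP[] ex /orP[] fx;
  rewrite ?(second _ ex) ?(second _ fx) ?ex ?fx //; exfalso;
  first [exact: src (eqP ex) (eqP fx) | exact: tgt (eqP ex) (eqP fx)].
Qed.

(** The comparison [o e (+) o' e] cannot change at a point, because the
    relation between two edges meeting there is the same for [o] and [o']; along
    a path of edges it is therefore constant. *)
Lemma orientation_unique_up_to_reversal o o' :
  is_knot w -> is_orientation o -> is_orientation o' ->
  forall e f, o e (+) o' e = o f (+) o' f.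
Proof.
move=> w_knot o_orient o'_orient.
have at_point x e f : incident e x -> incident f x ->
    o e (+) o' e = o f (+) o' f.
  have [-> //|e_neq_f] := eqVneq e f => ex fx.
  have := orientation_at_point o_orient e_neq_f ex fx.
  rewrite -(orientation_at_point o'_orient e_neq_f ex fx).
  by case: (o e); case: (o f); case: (o' e); case: (o' f).
move=> e f.
have ex : incident e (ends e).1 by rewrite /incident eqxx.
have fy : incident f (ends f).1 by rewrite /incident eqxx.
move: (ends e).1 (ends f).1 ex fy => x y ex fy.
have /connectP[p + y_last] := w_knot x y.
elim: p x e ex y_last => [|z p IH] x e ex /= y_last.
  by rewrite y_last in fy => _; exact: at_point ex fy.
case/andP=> /existsP[g xz] pth.
have [gx gz] : incident g x /\ incident g z.
  by case/orP: xz => /eqP E; rewrite /incident E /= !eqxx ?orbT.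
rewrite (at_point x e g ex gx); exact: IH gz y_last pth.
Qed.

(** * Directions along the strands *)

Lemma crossing_signE o (l : 'I_(size w)) (k := (letter_at l).1) :
  crossing_sign o l = letter_sign (letter_at l) *
    (-1) ^+ (o (strand l (lpos k)) (+) o (strand l (rpos k))).
Proof.
have direction_left : direction o (strand l (lpos k)) =
    if o (strand l (lpos k)) then (1, -1) else (-1, 1).
  by rewrite /direction /source /target; case: ifP => _ /=;
    rewrite tpermL /= /bump -/k; apply: f_equal2; lia.
have direction_right : direction o (strand l (rpos k)) =
    if o (strand l (rpos k)) then (-1, -1) else (1, 1).
  by rewrite /direction /source /target; case: ifP => _ /=;
    rewrite tpermR /= /bump -/k; apply: f_equal2; lia.
rewrite /crossing_sign /over_strand /under_strand /letter_sign -/k.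
by case: (letter_at l).2; rewrite direction_left direction_right;
  case: (o _); case: (o _).
Qed.

(** The point between the two strands is the second end of the upper one and
    the first end of the lower one, so both are directed downwards or both
    upwards. *)
Lemma strand_through_crossing o (l l' : 'I_(size w)) j :
  is_orientation o -> l' = l.+1 :> nat ->
  let k := (letter_at l).1 in
  o (strand l' (tperm (lpos k) (rpos k) j)) = o (strand l j).
Proof.
move=> o_orient l'E k; set j' := tperm _ _ j.
have lift_l : lift ord0 l = widen_ord (leqnSn _) l' :> 'I_(size w).+1.
  by apply: val_inj; rewrite /= l'E.
have neq : strand l j != strand l' j'.
  by apply/eqP => -[ll' _]; move: l'E; rewrite -ll'; lia.
have first_end : (ends (strand l j)).1 != (lift ord0 l, j').
  by apply/eqP => -[] /=; rewrite /bump; lia.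
have := orientation_at_point (x := (lift ord0 l, j')) o_orient neq.
rewrite /incident (negbTE first_end) /= lift_l !eqxx /=.
by move=> /(_ isT isT); case: (o _); case: (o _).
Qed.

(** The top endpoint [j] meets only its cap and the strand below it, so the
    strand goes down exactly when no cap starts at [j]. *)
Lemma rvecE o (l : 'I_(size w)) j :
  is_orientation o -> l = 0%N :> nat ->
  rvec o 0 j = if o (strand l j) then 2 else 1.
Proof.
move=> o_orient l0; rewrite mxE.
have strand_top : (ends (strand l j)).1 = (ord0, j).
  by apply: f_equal2 => //; exact: val_inj.
have [[e [e_src e_uniq]] _] := o_orient (ord0, j).
case: ifPn => [/existsP[i /eqP i_src]|no_cap]; case: ifPn => // o_strand.
  have strand_src : source o (strand l j) = (ord0, j).
    by rewrite /source o_strand.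
  by have := e_uniq _ i_src; rewrite (e_uniq _ strand_src).
case/negP: no_cap; apply/existsP.
have size_w_gt0 : (0 < size w)%N by rewrite (leq_ltn_trans _ (ltn_ord l)).
case: e e_src {e_uniq} => [[i src|[l' j']]|i].
- by exists i; rewrite src.
- rewrite /source; case: ifP => /= o_strand' [] //= l'0 j'j.
  by case/negP: o_strand; rewrite -j'j (_ : l = l') //; apply: val_inj; rewrite /= l0 l'0.
- by rewrite /source; case: ifP => _ [] /=; lia.
Qed.

(** Both sides change by the same transposition when [l] grows by one: the
    row through [Pletter], the strands by crossing each other. *)
Lemma row_records_directions o (l : 'I_(size w)) j : is_orientation o ->
  (rvec o *m Pmx (take l w)) 0 j = if o (strand l j) then 2 else 1.
Proof.
move=> o_orient; case: l => l l_lt; elim: l l_lt j => [|l IH] l_lt j.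
  by rewrite take0 /Pmx big_nil mulmx1; exact: rvecE.
have l_lt' : (l < size w)%N by exact: ltnW.
set l0 := Ordinal l_lt'.
have -> : take l.+1 w = rcons (take l w) (letter_at l0).
  by rewrite (take_nth (letter_at l0)) // -(tnth_nth _ (in_tuple w) l0).
rewrite Pmx_rcons mulmxA mul_row_Pletter (IH l_lt').
by rewrite -(@strand_through_crossing o l0 (Ordinal l_lt)) // tpermK.
Qed.

Lemma writhe_row_writhe o :
  is_orientation o -> writhe o = row_writhe (rvec o) w.
Proof.
move=> o_orient; rewrite row_writheE; apply: eq_bigr => l _.
rewrite crossing_signE /parallel_sign !row_records_directions //.
by case: (o _); case: (o _).
Qed.

Lemma writhe_orientation_irrelevant o o' :
  is_knot w -> is_orientation o -> is_orientation o' -> writhe o = writhe o'.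
Proof.
move=> w_knot o_orient o'_orient; apply: eq_bigr => l _.
rewrite !crossing_signE; set e := strand l _; set f := strand l _.
have := orientation_unique_up_to_reversal w_knot o_orient o'_orient e f.
by case: (o e); case: (o f); case: (o' e); case: (o' f).
Qed.

End Orientations.

(** * The writhe formula *)

Theorem theorem5p3 (n m : nat) (k : 'I_m -> 'I_(n.*2).-1) (eps : 'I_m -> int)
    (n_ge2 : (2 <= n)%N)
    (eps_neq0 : forall i : 'I_m, eps i <> 0)
    (k_reduced : forall i j : 'I_m, j = i.+1 :> nat -> k i <> k j)
    (K_knot : is_knot (braid_word k eps))
    (o o1 : edge (braid_word k eps) -> bool)
    (o_orient : is_orientation o)
    (o1_orient : is_orientation o1)
    (o1_clockwise : clockwise o1) :
  writhe o = \sum_(i < m) (-1) ^+ vnum k eps (rvec o1) i * eps i.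
Proof.
rewrite (writhe_orientation_irrelevant K_knot o_orient o1_orient).
by rewrite writhe_row_writhe // row_writhe_braid_word.
Qed.
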